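(* Let $X$ be a linear space, let $F:X\rightrightarrows\overline{Y}$ and $G:X\rightrightarrows U$ be set-valued maps, and let $S=\{x\in X : G(x)\cap(-D)\neq\emptyset\}$. Let $F$ be $C$-convex, let $G$ be $D$-convex, and let $$G(\operatorname{dom}F)\cap(-\operatorname{int}D)\neq\emptyset.$$ Then strong duality holds, that is, $$\operatorname{Sup}\bigcup_{T\in\mathcal{L}_+}\Phi(T)=\operatorname{Inf}\bigcup_{x\in S}F(x).$$
   Context: Spaces and cones. All linear spaces are real. $Y$ is a partially ordered linear topological space whose order is induced by a convex cone $C$ with $\emptyset\neq\operatorname{int}C\neq Y$. $\overline{Y}=Y\cup\{-\infty\}\cup\{+\infty\}$ with $-\infty\le y\le+\infty$ for all $y\in Y$. $U$ is a separated locally convex space and $D\subseteq U$ is a proper closed convex cone with nonempty interior. Sums of subsets of $\overline{Y}$ are elementwise (Minkowski) sums, with $A+\emptyset=\emptyset$, $y+(\pm\infty)=\pm\infty$ for $y\in Y$, $(+\infty)+(-\infty)=+\infty$, and $\alpha\cdot(\pm\infty)=\pm\infty$ for $\alpha>0$. Infimal and supremal sets. For $A\subseteq\overline{Y}$, the upper closure is $\operatorname{Cl}_+A=Y$ if $-\infty\in A$; $\operatorname{Cl}_+A=\emptyset$ if $A=\{+\infty\}$; and otherwise $\operatorname{Cl}_+A=\{y\in Y : \{y\}+\operatorname{int}C\subseteq (A\setminus\{+\infty\})+\operatorname{int}C\}$ (equivalently $\operatorname{cl}((A\setminus\{+\infty\})+C)$). For $A\subseteq Y$, $\operatorname{wMin}A=\{y\in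 A : (\{y\}-\operatorname{int}C)\cap A=\emptyset\}$. The infimal set is $\operatorname{Inf}A=\operatorname{wMin}\operatorname{Cl}_+A$ if $\emptyset\neq\operatorname{Cl}_+A\neq Y$; $\operatorname{Inf}A=\{-\infty\}$ if $\operatorname{Cl}_+A=Y$; $\operatorname{Inf}A=\{+\infty\}$ if $\operatorname{Cl}_+A=\emptyset$. The supremal set is defined symmetrically, $\operatorname{Sup}A=-\operatorname{Inf}(-A)$. For $A,B\subseteq\overline{Y}$, $A\preccurlyeq B$ means $\operatorname{Cl}_+A\supseteq\operatorname{Cl}_+B$. Domain and convexity. $\operatorname{dom}F=\{x\in X : F(x)\neq\{+\infty\}\}$ and $G(\operatorname{dom}F)=\bigcup_{x\in\operatorname{dom}F}G(x)$. $F$ is $C$-convex if $F(\lambda x_1+(1-\lambda)x_2)\preccurlyeq\lambda F(x_1)+(1-\lambda)F(x_2)$ for all $x_1,x_2\in X$, $\lambda\in(0,1)$. $G$ is $D$-convex if $\lambda G(x_1)+(1-\lambda)G(x_2)\subseteq G(\lambda x_1+(1-\lambda)x_2)+D$ for all $x_1,x_2\in X$, $\lambda\in(0,1)$. Operator dual. $\mathcal{L}$ is the set of all linear continuous operators from $U$ to $Y$ and $\mathcal{L}_+=\{T\in\mathcal{L} : T(D)\subseteq C\}$. For $x\in X$ and $T\in\mathcal{L}$, $L(x,T)=F(x)+T(G(x))$, where $T(A)=\{T(a) : a\in A\}$, and $\Phi(T)=\operatorname{Inf}\bigcup_{x\in X}L(x,T)$.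
   Formalization: The values F(x) are assumed nonempty for all x; with empty values allowed, a point with F(x)=∅ would lie in dom F={x : F(x)≠{+∞}}, and the Slater condition there would not give strong duality. *)

(* Defs.v *)
From HB Require Import structures.
From mathcomp Require Import all_boot all_order all_algebra.
From mathcomp Require Import all_classical all_reals all_analysis.
Set Implicit Arguments.
Unset Strict Implicit.
Unset Printing Implicit Defensive.
Import Order.TTheory GRing.Theory Num.Theory.
Import numFieldNormedType.Exports.
Local Open Scope classical_set_scope.
Local Open Scope ring_scope.

(* Cones are closed under multiplication by all scalars a >= 0, so that a      *)
(* nonempty cone contains 0 (the induced order y <= z <-> z - y \in C is       *)
(* reflexive). Cones need be neither closed nor pointed.                       *)
Definition cone (R : realType) (V : lmodType R) (K : set V) : Prop :=
  forall (a : R) (v : V), 0 <= a -> K v -> K (a *: v).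

Definition convex_cone (R : realType) (V : lmodType R) (K : set V) : Prop :=
  convex_set (K : set (convex_lmodType V)) /\ cone K.

(* The space Y extended by -oo and +oo is the library type \bar Y. It is       *)
(* used with the inf-addition dual_adde, for which +oo + -oo = +oo, rather     *)
(* than with adde, for which +oo + -oo = -oo.                                  *)
Definition esetD (V : nmodType) (A B : set (\bar V)) : set (\bar V) :=
  [set dual_adde a b | a in A & b in B].

Definition esetN (V : zmodType) (A : set (\bar V)) : set (\bar V) :=
  [set oppe a | a in A].

(* Only meaningful for a > 0: er_map fixes both -oo and +oo. *)
Definition esetZ (R : realType) (V : lmodType R) (a : R) (A : set (\bar V)) :
    set (\bar V) :=
  [set er_map ( *:%R a) v | v in A].

Section InfimalSets.
Context (R : realType) (Y : topologicalLmodType R).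
Variable C : set Y.
Implicit Types A B : set (\bar Y).

Definition upper_closure A : set Y :=
  if `[< A -oo%E >] then setT
  else if `[< A = [set +oo%E] >] then set0
  else [set y | esetD [set y%:E] (EFin @` C°) `<=`
                esetD (A `\ +oo%E) (EFin @` C°)].

Definition wMin (B : set Y) : set Y :=
  [set y | B y /\ [set y - c | c in C°] `&` B = set0].

Definition Inf A : set (\bar Y) :=
  if `[< upper_closure A = set0 >] then [set +oo%E]
  else if `[< upper_closure A = setT >] then [set -oo%E]
  else EFin @` wMin (upper_closure A).

Definition Sup A : set (\bar Y) := esetN (Inf (esetN A)).

Definition preceq A B : Prop := upper_closure B `<=` upper_closure A.

End InfimalSets.

Section SetValuedMaps.
Context (R : realType) (X : lmodType R).
Context (Y : topologicalLmodType R) (U : tvsType R).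
Variables (C : set Y) (D : set U).
Variables (F : X -> set (\bar Y)) (G : X -> set U).

(* The value [set +oo] plays the role of an empty value, so dom F is meaningful *)
(* only for maps F all of whose values are nonempty.                           *)
Definition dom : set X := [set x | F x <> [set +oo%E]].

Definition C_convex : Prop :=
  forall (x1 x2 : X) (lambda : R), 0 < lambda -> lambda < 1 ->
    preceq C (F (lambda *: x1 + (1 - lambda) *: x2))
             (esetD (esetZ lambda (F x1)) (esetZ (1 - lambda) (F x2))).

Definition D_convex : Prop :=
  forall (x1 x2 : X) (lambda : R), 0 < lambda -> lambda < 1 ->
    [set lambda *: u1 + (1 - lambda) *: u2 | u1 in G x1 & u2 in G x2] `<=`
    [set u + d | u in G (lambda *: x1 + (1 - lambda) *: x2) & d in D].

Definition feasible : set X := [set x | G x `&` [set - d | d in D] !=set0].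

Definition Lplus : set {linear U -> Y} :=
  [set T : {linear U -> Y} | continuous T /\ T @` D `<=` C].

Definition Lagrangian (x : X) (T : {linear U -> Y}) : set (\bar Y) :=
  esetD (F x) (EFin @` (T @` G x)).

Definition Phi (T : {linear U -> Y}) : set (\bar Y) :=
  Inf C (\bigcup_(x in [set: X]) Lagrangian x T).

End SetValuedMaps.

(* Main.v *)
From HB Require Import structures.
Require Import Defs.
From mathcomp Require Import all_boot all_order all_algebra.
From mathcomp Require Import all_classical all_reals all_analysis.
From mathcomp Require Import lra.
Import Order.TTheory GRing.Theory Num.Theory.
Import numFieldNormedType.Exports.
Local Open Scope classical_set_scope.
Local Open Scope ring_scope.

(** Strong duality comes from separating a point from a convex set. Write [K] for
    the interior of [C]. The infimal set of [A] is determined by the open set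
    [strict_upper K A] of the points strictly above some element of [A]: when
    this set is neither empty nor full, the infimal set is its lower frontier
    ([Inf_finite]), and otherwise it is [+oo] or [-oo]. Everything below is
    expressed with strict upper sets, for which only algebraic properties of the
    open cone [K] matter.

    Weak duality ([weak_duality]) says that for [T] in [Lplus] the strict upper
    set of the primal values is contained in that of the Lagrangian. For strong
    duality, take [y0] outside the strict upper set of the primal values. The
    strict epigraph of the perturbed problems is a convex, algebraically open
    subset of [Y * U] that does not contain [(y0, 0)], so that a linear
    functional separates the two ([open_convex_separation], a Hahn-Banach theorem
    obtained from [positive_functional]). The separation is purely algebraic; the
    component of the functional on [U] is continuous because it is nonnegative on
    a cone with interior points. This component, multiplied by a suitable vector
    of [K], is an operator [T] in [Lplus] for which [y0] is outside the strict
    upper set of the Lagrangian ([exists_multiplier]).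

    Consequently every frontier point of the primal values is a dual value, while
    no dual value is strictly above the primal ones. Thus the points strictly
    below the dual values form the complement of the closed upper set of the
    primal values ([strict_upper_dual]); the frontiers of the two sets coincide,
    which is the equality of the supremal and infimal sets. Slater's condition
    also ensures that the primal values are not all [+oo]. *)

(** * Positive functionals on ordered vector spaces *)

Section PositiveFunctional.
Set Implicit Arguments.
Unset Strict Implicit.
Context (R : realType) (V : lmodType R).
Implicit Types (P Q : set V) (u v w : V).

Definition pos_scale_closed P := forall (a : R) v, 0 < a -> P v -> P (a *: v).

Definition wedge P :=
  [/\ P 0, forall u v, P u -> P v -> P (u + v) & pos_scale_closed P].

(** By Zorn's lemma there is a maximal wedge [Q] above [P] avoiding [- e]. If
    neither [v] nor [- v] were in [Q], enlarging [Q] by either direction would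
    produce [- e = q + t *: v = q' - s *: v] with [t, s > 0]; cancelling [v]
    writes a positive multiple of [- e] as an element of [Q]. *)
Lemma maximal_wedge P e : wedge P -> ~ P (- e) ->
  exists Q, [/\ P `<=` Q, wedge Q, ~ Q (- e) & forall v, Q v \/ Q (- v)].
Proof.
move=> wP Pe.
pose adm (A : set V) := wedge (A `|` P) /\ ~ (A `|` P) (- e).
have [F admF totF|A [[wA Ae] maxA]] := @Zorn_bigcup V adm.
  have [->|/set0P[A0 FA0]] := eqVneq F set0.
    by rewrite /adm bigcup_set0 set0U.
  have memU v : (\bigcup_(A in F) A `|` P) v <-> exists2 A, F A & (A `|` P) v.
    split=> [[[A FA Av]|Pv]|[A FA [Av|Pv]]].
    - by exists A => //; left.
    - by exists A0 => //; right.
    - by left; exists A.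
    - by right.
  split; last by move/memU => [A /admF[_]].
  split.
  - by right; case: wP.
  - move=> u v /memU[A FA Au] /memU[B FB Bv]; apply/memU.
    have [AB|BA] := totF A B FA FB.
      exists B => //; have [[_ addB _] _] := admF _ FB; apply: addB => //.
      by move: Au => [/AB|]; [left|right].
    exists A => //; have [[_ addA _] _] := admF _ FA; apply: addA => //.
    by move: Bv => [/BA|]; [left|right].
  - move=> a v a0 /memU[A FA Av]; apply/memU; exists A => //.
    by have [[_ _ scA] _] := admF _ FA; exact: scA.
have {}maxA B : wedge B -> A `|` P `<=` B -> ~ B (- e) -> B `<=` A `|` P.
  move=> wB AB Be; have BP : B `|` P = B.
    by apply/setUidPl => v Pv; apply: AB; right.
  apply: contrapT => nBA; apply: (maxA B); last by rewrite /adm BP.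
  split; first by move=> v Av; apply: AB; left.
  by move=> BA; apply: nBA => v /BA; left.
exists (A `|` P); split; [by move=> v Pv; right|by []|by []|].
set Q := A `|` P in wA Ae maxA *; case: (wA) => Q0 addQ scQ.
(* a maximal wedge enlarged by a new direction must contain - e *)
have grow v : ~ Q v -> exists2 q, Q q & exists2 t, 0 < t & - e = q + t *: v.
  move=> nQv.
  pose B := [set w | exists2 q, Q q & exists2 t, 0 <= t & w = q + t *: v].
  have QB : Q `<=` B.
    by move=> q Qq; exists q => //; exists 0; rewrite ?scale0r ?addr0.
  have wB : wedge B.
    split; first exact: QB.
      move=> _ _ [q Qq [t t0 ->]] [q' Qq' [t' t'0 ->]].
      exists (q + q'); first exact: addQ.
      by exists (t + t'); rewrite ?addr_ge0// scalerDl addrACA.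
    move=> a _ a0 [q Qq [t t0 ->]]; exists (a *: q); first exact: scQ.
    by exists (a * t); [rewrite mulr_ge0// ltW|rewrite scalerDr scalerA].
  have Bv : B v by exists 0 => //; exists 1; rewrite ?scale1r ?add0r.
  have [[q Qq [t]]|nBe] := pselect (B (- e)); last first.
    by exfalso; exact/nQv/(maxA _ wB).
  rewrite le_eqVlt => /predU1P[<-|t0 eE]; last by exists q => //; exists t.
  by rewrite scale0r addr0 => eE; rewrite eE in Ae.
move=> v; apply: contrapT => /not_orP[].
move=> /grow[q Qq [t t0 eq]] /grow[q' Qq' [s s0 eq']].
apply: Ae.
have /(scQ (s + t)^-1) : Q (s *: q + t *: q') by apply: addQ; exact: scQ.
have -> : s *: q + t *: q' = (s + t) *: (- e).
  rewrite [RHS]scalerDl [in s *: - e]eq eq'.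
  rewrite !(scalerDr, scalerN, scalerA) (mulrC s t).
  by rewrite addrACA subrr addr0.
rewrite scalerA mulVf ?scale1r ?gt_eqF ?addr_gt0// => h.
by apply: h; rewrite invr_gt0 addr_gt0.
Qed.

(** This is the Hahn-Banach theorem in its order form, for an order unit [e].
    A total wedge [Q] containing [P] orders the line spanned by [e] against
    every vector [v]: the set [S v] of those [r] with [r *: e] below [v] is a
    lower half-line, and its supremum defines the functional. Superadditivity
    of [S], applied to [v] and to [- v], gives additivity. *)
Lemma positive_functional P e : wedge P ->
  (forall v, exists2 a : R, 0 < a & P (e + a *: v)) -> ~ P (- e) ->
  exists f : {linear V -> R^o}, (forall v, P v -> 0 <= f v) /\ f e = 1.
Proof.
move=> wP unitP /(maximal_wedge wP)[Q [PQ [Q0 addQ scQ] Qe totQ]].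
pose S v : set R := [set r | Q (v - r *: e)].
have Se : Q e by have [a _ /PQ] := unitP 0; rewrite scaler0 addr0.
have Sle v r s : S v r -> s < r -> S v s.
  move=> Sr sr; rewrite /S /=.
  have -> : v - s *: e = (v - r *: e) + (r - s) *: e.
    by rewrite scalerBl addrA subrK.
  by apply: addQ => //; apply: scQ => //; rewrite subr_gt0.
have SD v w r s : S v r -> S w s -> S (v + w) (r + s).
  by move=> Sr Ss; rewrite /S /= scalerDl opprD addrACA; exact: addQ.
have SN v r : ~ S v r -> S (- v) (- r).
  move=> nS; have [//|] := totQ (v - r *: e).
  by rewrite /S /= opprB scaleNr opprK addrC.
have Sub v r s : S v r -> S (- v) (- s) -> r <= s.
  move=> Sr /(SD _ _ _ _ Sr); rewrite subrr /S /= sub0r -scaleNr => Qrs.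
  rewrite leNgt; apply/negP => sr; apply: Qe.
  have /scQ/(_ Qrs) : 0 < (r - s)^-1 by rewrite invr_gt0 subr_gt0.
  by rewrite scalerA mulrN mulVf ?scaleN1r// gt_eqF// subr_gt0.
have S0 v : S v !=set0.
  have [a a0 /PQ/(scQ a^-1)] := unitP v.
  rewrite invr_gt0 => /(_ a0); rewrite scalerDr scalerA mulVf ?gt_eqF// scale1r.
  by move=> h; exists (- a^-1); rewrite /S /= scaleNr opprK addrC.
have hasS v : has_sup (S v).
  split; first exact: S0.
  by have [s Ss] := S0 (- v); exists (- s) => r Sr; apply: (Sub v); rewrite ?opprK.
pose f v : R := sup (S v).
have ltf v r : r < f v -> S v r.
  rewrite -subr_gt0 => /(sup_adherent)/(_ (hasS v))[s Ss].
  by rewrite /f opprB addrC subrK => /(Sle _ _ _ Ss).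
(* by totality, membership of [- r] in [S (- v)] replaces [~ S v r], which does
   not add up *)
have gtf v r : f v < r -> S (- v) (- r).
  by move=> fr; apply: SN => /(sup_upper_bound (hasS v)); rewrite leNgt fr.
have fE v r : (forall s, s < r -> S v s) -> (forall s, r < s -> S (- v) (- s)) ->
    f v = r.
  move=> ltr gtr; apply/eqP; rewrite eq_le; apply/andP; split; apply/ler_addgt0Pr.
    move=> d d0; rewrite leNgt; apply/negP => /ltf Sd.
    have /gtr/(Sub _ _ _ Sd) : r < r + d / 2 by rewrite ltrDl divr_gt0.
    lra.
  move=> d d0; rewrite -lerBlDr leNgt; apply/negP => /gtf Sd.
  have /ltr/Sub/(_ Sd) : r - d / 2 < r by rewrite gtrBl divr_gt0.
  lra.
have fD v w : f (v + w) = f v + f w.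
  apply: fE => s fs.
    have -> : s = (f v - (f v + f w - s) / 2) + (f w - (f v + f w - s) / 2) by lra.
    by apply: SD; apply: ltf; lra.
  have -> : - s = - (f v + (s - f v - f w) / 2) - (f w + (s - f v - f w) / 2) by lra.
  by rewrite opprD; apply: SD; apply: gtf; lra.
have f0 : f 0 = 0 by apply: (addrI (f 0)); rewrite -fD !addr0.
have fN v : f (- v) = - f v by apply/eqP; rewrite -addr_eq0 -fD addNr f0.
have Spos a v r : 0 < a -> S v (r / a) -> S (a *: v) r.
  move=> a0 /(scQ _ _ a0); rewrite scalerBr scalerA mulrC divfK ?gt_eqF//.
have fZpos a v : 0 < a -> f (a *: v) = a * f v.
  move=> a0; apply: fE => s; rewrite -?scalerN => fs; apply: Spos => //.
    by apply: ltf; rewrite ltr_pdivrMr// mulrC.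
  by rewrite mulNr; apply: gtf; rewrite ltr_pdivlMr// mulrC.
have fZ a v : f (a *: v) = a * f v.
  have [a0|a0|->] := ltgtP a 0; last by rewrite scale0r f0 mul0r.
    by apply: oppr_inj; rewrite -fN -scaleNr fZpos ?oppr_gt0// mulNr.
  exact: fZpos.
have flin : linear (f : V -> R^o) by move=> a v w; rewrite fD fZ.
pose g : {linear V -> R^o} :=
  HB.pack (f : V -> R^o) (GRing.isLinear.Build R V R^o *:%R f flin).
exists g.
split => [v /PQ Qv|] /=.
  by apply: sup_upper_bound => //; rewrite /S /= scale0r subr0.
have Se1 s : S e s <-> Q ((1 - s) *: e) by rewrite scalerBl scale1r.
apply: fE => s s1; first by apply/Se1/scQ; rewrite ?subr_gt0.
rewrite /S /= scaleNr opprK addrC -{2}[e]scale1r -scalerBl.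
by apply: scQ; rewrite ?subr_gt0.
Qed.

End PositiveFunctional.

(** * Open convex cones and separation *)

Section AlgebraicallyOpenCones.
Set Implicit Arguments.
Unset Strict Implicit.
Context (R : realType) (V : lmodType R).
Implicit Types (K : set V).

(** Openness along lines: the only trace of the topology that the separation
    argument and the description of infimal sets use. *)
Definition algebraically_open K :=
  forall u v, K u -> exists2 e : R, 0 < e &
    forall t, 0 <= t -> t <= e -> K (u + t *: v).

Definition open_convex_cone K :=
  [/\ K !=set0, forall u v, K u -> K v -> K (u + v), pos_scale_closed K &
      algebraically_open K].

Lemma open_convex_coneB K u v : open_convex_cone K -> K u ->
  exists2 e : R, 0 < e & K (u - e *: v).
Proof.
move=> [_ _ _ oK] /(oK _ (- v))[e e0 Ke]; exists e => //.
by rewrite -scalerN; apply: Ke => //; exact: ltW.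
Qed.

Lemma open_convex_cone_absorb K k v : open_convex_cone K -> K k ->
  exists2 t : R, 0 < t & K (t *: k - v).
Proof.
move=> oK Kk; have [e e0 Ke] := open_convex_coneB v oK Kk.
exists e^-1; rewrite ?invr_gt0//; case: oK => _ _ scK _.
have /scK/(_ Ke) : 0 < e^-1 by rewrite invr_gt0.
by rewrite scalerBr scalerA mulVf ?gt_eqF// scale1r.
Qed.

(** Twice the midpoint. *)
Lemma convex_coneD (C : set V) u v : convex_cone C -> C u -> C v -> C (u + v).
Proof.
move=> [cC coneC] Cu Cv.
have hl : 0 <= 2^-1 :> R by lra.
have hu : 2^-1 <= 1 :> R by lra.
have : C (2^-1 *: u + (1 - 2^-1) *: v).
  exact: set_mem (cC _ _ (Itv01 hl hu) (mem_set Cu) (mem_set Cv)).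
move=> /(coneC 2) -/(_ (ler0n _ _)).
have -> : 1 - 2^-1 = 2^-1 :> R by lra.
by rewrite -scalerDr scalerA mulfV// scale1r.
Qed.

(** The positive functional is taken for the wedge generated by [M - p], with
    order unit [m0 - p] for any [m0] in [M]. The opposite of the unit is not
    in the wedge, as otherwise a convex combination of points of [M] would be
    [p]. The inequality is strict because [M] allows a small step in the
    direction of [p], along which [f] decreases. *)
Lemma open_convex_separation (M : set V) p : M !=set0 ->
  (forall u v (l : R), 0 < l -> l < 1 -> M u -> M v ->
    M (l *: u + (1 - l) *: v)) ->
  algebraically_open M -> ~ M p ->
  exists f : {linear V -> R^o}, forall m, M m -> f p < f m.
Proof.
move=> [m0 Mm0] cM oM nMp.
(* positive combinations of vectors [m - p] are multiples of such a vector *)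
have mix (t s : R) u v : 0 < t -> 0 < s -> M u -> M v ->
    exists2 w, M w & t *: (u - p) + s *: (v - p) = (t + s) *: (w - p).
  move=> t0 s0 Mu Mv; have ts0 : t + s != 0 by rewrite gt_eqF ?addr_gt0.
  exists ((t / (t + s)) *: u + (1 - t / (t + s)) *: v).
    apply: cM => //; first by rewrite divr_gt0 ?addr_gt0.
    by rewrite ltr_pdivrMr ?addr_gt0// mul1r ltrDl.
  have -> : 1 - t / (t + s) = s / (t + s).
    by rewrite -{1}(mulfV ts0) -mulrBl addrAC subrr add0r.
  rewrite [RHS]scalerBr [in RHS]scalerDr !scalerA ![(t + s) * _]mulrC !divfK//.
  by rewrite !scalerBr scalerDl opprD addrACA.
pose P v := v = 0 \/ exists2 t : R, 0 < t & exists2 m, M m & v = t *: (m - p).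
have wP : wedge P.
  split; first by left.
    move=> u v [->|[t t0 [m Mm ->]]]; first by rewrite add0r.
    case=> [->|[s s0 [m' Mm' ->]]].
      by rewrite addr0; right; exists t => //; exists m.
    have [w Mw ->] := mix _ _ _ _ t0 s0 Mm Mm'.
    by right; exists (t + s); [rewrite addr_gt0|exists w].
  move=> a v a0 [->|[t t0 [m Mm ->]]]; first by left; rewrite scaler0.
  by right; exists (a * t); [rewrite mulr_gt0|exists m; rewrite ?scalerA].
have MP m : M m -> P (m - p).
  by move=> Mm; right; exists 1 => //; exists m; rewrite ?scale1r.
have unitP v : exists2 a : R, 0 < a & P (m0 - p + a *: v).
  have [e e0 Me] := oM _ v Mm0; exists e => //; rewrite addrAC; apply: MP.
  by apply: Me => //; exact: ltW.
have nPe : ~ P (- (m0 - p)).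
  case=> [/eqP|[t t0 [m Mm eE]]].
    by rewrite oppr_eq0 subr_eq0 => /eqP mp; rewrite mp in Mm0.
  have [w Mw] := mix _ _ _ _ ltr01 t0 Mm0 Mm.
  rewrite -eE scale1r subrr => /esym/eqP; rewrite scaler_eq0 gt_eqF ?addr_gt0//=.
  by rewrite subr_eq0 => /eqP wp; rewrite wp in Mw.
have [f [fP fe]] := positive_functional wP unitP nPe.
exists f => m Mm; have [e e0 Me] := oM _ (- (m0 - p)) Mm.
have /MP/fP : M (m + e *: (- (m0 - p))) by apply: Me => //; exact: ltW.
by rewrite addrAC linearD linearZ linearN fe linearB /= /GRing.scale /=; lra.
Qed.

End AlgebraicallyOpenCones.

Section Interior.
Set Implicit Arguments.
Unset Strict Implicit.
Context (R : realType) (Y : topologicalLmodType R).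

Lemma nbhs_affine (a : R) (b y : Y) (A : set Y) :
  nbhs (a *: y + b) A -> nbhs y [set z | A (a *: z + b)].
Proof.
move: A; apply: (@continuous_comp _ _ _ (fun y => (a *: y, b))
  (fun x : Y * Y => x.1 + x.2)); last exact: add_continuous.
apply: cvg_pair; last exact: cvg_cst.
apply: (@continuous_comp Y (R^o * Y)%type Y (fun y => (a, y))
  (fun z => z.1 *: z.2)); last exact: scale_continuous.
by apply: (@cvg_pair _ _ _ _ (nbhs (a : R^o))); [exact: cvg_cst|exact: cvg_id].
Qed.

Lemma nbhs_line (u v : Y) (t : R^o) (A : set Y) :
  nbhs (u + t *: v) A -> nbhs t [set s | A (u + s *: v)].
Proof.
move: A; apply: (@continuous_comp _ _ _ (fun t : R^o => (u, t *: v))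
  (fun x : Y * Y => x.1 + x.2)); last exact: add_continuous.
apply: cvg_pair; first exact: cvg_cst.
apply: (@continuous_comp R^o (R^o * Y)%type Y (fun t => (t, v))
  (fun z => z.1 *: z.2)); last exact: scale_continuous.
by apply: (@cvg_pair _ _ _ _ (nbhs (t : R^o))); [exact: cvg_id|exact: cvg_cst].
Qed.

Lemma interior_algebraically_open (C : set Y) : algebraically_open C°.
Proof.
move=> u v Cu; have nb : nbhs (u + (0 : R^o) *: v) C°.
  by rewrite scale0r addr0; exact: nbhs_interior.
have /nbhs_ballP[e /= e0 Ce] := nbhs_line nb.
exists (e / 2) => [|t t0 te]; first by rewrite divr_gt0.
by apply: Ce; rewrite /ball /= sub0r normrN ger0_norm//; lra.
Qed.

Lemma interior_convex_coneD (C : set Y) u v :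
  convex_cone C -> C u -> C° v -> C° (u + v).
Proof.
move=> cC Cu Cv; have nb : nbhs (1 *: (u + v) - u) C.
  by rewrite scale1r addrC addrA addNr add0r.
apply: filterS (nbhs_affine nb) => y /= Cy.
by rewrite -[y](subrK u) addrC; apply: convex_coneD => //; rewrite scale1r in Cy.
Qed.

Lemma interior_cone_scale (C : set Y) : cone C -> pos_scale_closed C°.
Proof.
move=> cC a v a0 Cv; have nb : nbhs (a^-1 *: (a *: v) + 0) C.
  by rewrite addr0 scalerA mulVf ?gt_eqF// scale1r.
apply: filterS (nbhs_affine nb) => y /= /(cC a) -/(_ (ltW a0)).
by rewrite addr0 scalerA mulfV ?gt_eqF// scale1r.
Qed.

Lemma interior_open_convex_cone (C : set Y) :
  convex_cone C -> C° !=set0 -> open_convex_cone C°.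
Proof.
move=> cC C0; split => //; last exact: interior_algebraically_open.
  by move=> u v /interior_subset Cu; exact: interior_convex_coneD.
by case: cC => _; exact: interior_cone_scale.
Qed.

(** Near an interior point [d0] of [D], displacements [v] such that [d0 + v] and
    [d0 - v] are in [D] satisfy [`|f v| <= f d0]. Rescaling them makes this
    bound arbitrarily small. *)
Lemma positive_linear_continuous (f : {linear Y -> R^o}) (D : set Y) :
  (forall d, D d -> 0 <= f d) -> D° !=set0 -> continuous f.
Proof.
move=> f0 [d0 Dd0] y; apply/cvgrPdist_lt => eps eps0.
have fd0 : 0 <= f d0 by apply: f0; exact: interior_subset.
have fd1 : 0 < f d0 + 1 by lra.
have [r r0 rE] : exists2 r : R, 0 < r & eps = (f d0 + 1) / r.
  exists ((f d0 + 1) / eps); first by rewrite divr_gt0.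
  by rewrite invf_div mulrCA mulfV ?mulr1// gt_eqF.
have nb1 : nbhs (r *: y + (d0 - r *: y)) D by rewrite addrCA subrr addr0.
have nb2 : nbhs ((- r) *: y + (d0 + r *: y)) D.
  by rewrite addrCA scaleNr addNr addr0.
near=> z.
have z1 : 0 <= f (r *: z + (d0 - r *: y)).
  by apply: f0; near: z; exact: (nbhs_affine nb1).
have z2 : 0 <= f ((- r) *: z + (d0 + r *: y)).
  by apply: f0; near: z; exact: (nbhs_affine nb2).
move: z1 z2; rewrite !(linearD, linearN, linearZ) /= => z1 z2.
have : r * `|f y - f z| < f d0 + 1.
  rewrite -{1}(gtr0_norm r0) -normrM ltr_norml; apply/andP.
  by move: z1 z2; rewrite mulrBr /GRing.scale /= => z1 z2; split; lra.
by rewrite rE ltr_pdivlMr// mulrC.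
Unshelve. all: by end_near. Qed.

End Interior.

(** * Strict upper sets and infimal sets *)

Section OpenUpperSets.
Set Implicit Arguments.
Unset Strict Implicit.
Context (R : realType) (V : lmodType R) (K : set V).
Hypothesis oK : open_convex_cone K.
Implicit Types (E : set V) (A B : set (\bar V)) (y k : V).

Definition open_upper E :=
  (forall y k, E y -> K k -> E (y + k)) /\
  (forall y k, E y -> K k -> exists2 e : R, 0 < e & E (y - e *: k)).

(** When [E] is an open upper set, these are the weakly minimal points of its
    closure, expressed through [E] itself. *)
Definition lower_frontier E : set V :=
  [set y | ~ E y /\ forall k, K k -> E (y + k)].

(** The ray from [z] in direction [k] enters [E], since [k] absorbs every
    vector, but not before time [1]; it enters [E] at a point of the frontier. *)
Lemma open_upper_ray E z k : open_upper E -> E !=set0 -> K k -> ~ E (z + k) ->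
  exists2 a, lower_frontier E a & K (a - z).
Proof.
move=> [upE opE] [p Ep] Kk nEk; have [_ addK scK _] := oK.
pose I : set R := [set t | E (z + t *: k)].
have I1 t : I t -> 1 <= t.
  move=> It; rewrite leNgt; apply/negP => t1; apply: nEk.
  have -> : z + k = (z + t *: k) + (1 - t) *: k.
    by rewrite scalerBl scale1r addrA addrAC addrK.
  by apply: upE => //; apply: scK => //; rewrite subr_gt0.
have hasI : has_inf I.
  split; last by exists 1 => t /I1.
  have [t _ Kt] := open_convex_cone_absorb (p - z) oK Kk.
  have zE : z + t *: k = p + (t *: k - (p - z)).
    by rewrite opprB addrCA (addrC p) subrK addrC.
  by exists t; rewrite /I /= zE; exact: upE.
have infI t : I t -> inf I <= t by move=> It; apply: ge_inf => //; exact: hasI.2.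
have inf1 : 1 <= inf I by apply: lb_le_inf; [exact: hasI.1|].
exists (z + inf I *: k); last first.
  by rewrite addrC addKr; apply: scK => //; lra.
split=> [/(opE _ _)/(_ Kk)[e e0]|k' Kk'].
  by rewrite -addrA -scalerBl => /infI; lra.
have [e e0 Ke] := open_convex_coneB k oK Kk'.
have [t It te] := inf_adherent e0 hasI.
have -> : z + inf I *: k + k' =
    (z + t *: k) + ((inf I + e - t) *: k + (k' - e *: k)).
  rewrite scalerBl scalerDl -!addrA; congr (_ + _).
  rewrite [RHS]addrC -!addrA; congr (_ + _).
  by rewrite addrA addrCA [- _ + _]addrC -opprB addNr addr0.
by apply: upE => //; apply: addK => //; apply: scK => //; rewrite subr_gt0.
Qed.

(** For [K] the interior of the ordering cone, this is the interior of the upper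
    closure of [A]. Unlike the upper closure, it commutes with unions, so that the
    union over all [x] in the primal and dual values can be treated pointwise. *)
Definition strict_upper A : set V :=
  [set y | A -oo%E \/ exists2 a, A a%:E & K (y - a)].

Lemma strict_upper_open A : open_upper (strict_upper A).
Proof.
have [_ addK _ _] := oK.
split=> y k [Ay|[a Aa Ka]] Kk.
- by left.
- by right; exists a => //; rewrite addrAC; exact: addK.
- by exists 1 => //; left.
- have [e e0 Ke] := open_convex_coneB k oK Ka.
  by exists e => //; right; exists a => //; rewrite addrAC.
Qed.

Lemma strict_upper_bigcup (I : Type) (S : set I) (A : I -> set (\bar V)) :
  strict_upper (\bigcup_(i in S) A i) = \bigcup_(i in S) strict_upper (A i).
Proof.
apply/seteqP; split=> y.
  by case=> [[i Si Ai]|[a [i Si Ai] Ka]]; exists i => //; [left|right; exists a].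
by case=> i Si [Ai|[a Aa Ka]]; [left|right; exists a => //]; exists i.
Qed.

Lemma strict_upper_conv A B (l : R) y z : 0 < l -> l < 1 ->
  strict_upper A y -> strict_upper B z ->
  strict_upper (esetD (esetZ l A) (esetZ (1 - l) B)) (l *: y + (1 - l) *: z).
Proof.
move=> l0 l1; have [_ addK scK _] := oK.
case=> [Ay|[a Aa Ka]] [Bz|[b Bb Kb]].
- left; exists -oo%E; first by exists -oo%E.
  by exists -oo%E => //; exists -oo%E.
- left; exists -oo%E; first by exists -oo%E.
  by exists ((1 - l) *: b)%:E => //; exists b%:E.
- left; exists (l *: a)%:E; first by exists a%:E.
  by exists -oo%E => //; exists -oo%E.
- right; exists (l *: a + (1 - l) *: b).
    exists (l *: a)%:E; first by exists a%:E.
    by exists ((1 - l) *: b)%:E => //; exists b%:E.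
  rewrite opprD addrACA -!scalerBr; apply: addK; apply: scK => //.
  by rewrite subr_gt0.
Qed.

Lemma strict_upper_translate A (W : set V) :
  strict_upper (esetD A (EFin @` W)) =
  [set y | exists2 w, W w & strict_upper A (y - w)].
Proof.
apply/seteqP; split=> y.
  case=> [[x Ax [_ [w Ww <-]]]|[b [x Ax [_ [w Ww <-]]]]].
    by case: x Ax => [a||] Aoo // _; exists w => //; left.
  case: x Ax => [a||] Aa // -[<-] Ka; exists w => //; right; exists a => //.
  by rewrite -addrA -opprD [w + a]addrC.
case=> w Ww [Ay|[a Aa Ka]].
  by left; exists -oo%E => //; exists w%:E => //; exists w.
right; exists (a + w); last by rewrite opprD addrA addrAC.
by exists a%:E => //; exists w%:E => //; exists w.
Qed.

End OpenUpperSets.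

Section InfimalSets.
Set Implicit Arguments.
Unset Strict Implicit.
Context (R : realType) (Y : topologicalLmodType R) (C : set Y).
Hypothesis oC : open_convex_cone C°.
Implicit Types (A B : set (\bar Y)).

Local Notation SU := (strict_upper C°).

Lemma upper_closureE A :
  upper_closure C A = [set y | forall k, C° k -> SU A (y + k)].
Proof.
have [[k0 Ck0] _ _ _] := oC.
rewrite /upper_closure; case: asboolP => [Aoo|nAoo].
  by apply/seteqP; split=> // y _ k _; left.
case: asboolP => [->|Apoo]; apply/seteqP; split=> // y.
- by move=> /(_ _ Ck0)[//|[a]].
- move=> /= ey k Ck; right.
  have /ey : esetD [set y%:E] (EFin @` C°) (y + k)%:E.
    by exists y%:E => //; exists k%:E => //; exists k.
  case=> [[a||] [//= Aa _]] [_ [c Cc <-]] // [<-].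
  by exists a => //; rewrite addrAC subrr add0r.
- move=> /= ey _ [_ -> [_ [k Ck <-] <-]].
  have [//|[a Aa Ca]] := ey k Ck.
  exists a%:E; first by split.
  exists (y + k - a)%:E; first by exists (y + k - a).
  by rewrite /dual_adde /= addrC subrK.
Qed.

(** The strict upper set is recovered from the upper closure, so that each of
    the two sets determines the other. *)
Lemma strict_upperP A y :
  SU A y <-> exists2 k, C° k & upper_closure C A (y - k).
Proof.
have [[k0 Ck0] _ _ _] := oC; have [upE opE] := strict_upper_open oC A.
rewrite upper_closureE; split=> [Ay|[k Ck /(_ k Ck)]]; last by rewrite subrK.
have [e e0 Ee] := opE _ _ Ay Ck0.
exists (e *: k0); first by case: oC => _ _ scC _; exact: scC.
by move=> k Ck; exact: upE.
Qed.

Lemma preceq_strict_upper A B : preceq C A B -> SU B `<=` SU A.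
Proof.
by move=> AB y /strict_upperP[k Ck /AB ABk]; apply/strict_upperP; exists k.
Qed.

Lemma upper_closure0 A : upper_closure C A = set0 <-> SU A = set0.
Proof.
have [[k0 Ck0] _ _ _] := oC; split=> E0; rewrite -subset0 => y.
  by move=> /strict_upperP[k _]; rewrite E0.
by rewrite upper_closureE => /(_ _ Ck0); rewrite E0.
Qed.

Lemma upper_closureT A : upper_closure C A = setT <-> SU A = setT.
Proof.
have [[k0 Ck0] _ _ _] := oC; split=> ET; rewrite -subTset => y _.
  by apply/strict_upperP; exists k0; rewrite ?ET.
by rewrite upper_closureE => k _; rewrite ET.
Qed.

Lemma wMin_upper_closure A :
  wMin C (upper_closure C A) = lower_frontier C° (SU A).
Proof.
apply/seteqP; split=> y [h1 h2].
  split; last by move: h1; rewrite upper_closureE.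
  move=> /strict_upperP[k Ck Ak]; rewrite -[False]/(set0 (y - k)) -h2.
  by split=> //; exists k.
split; first by rewrite upper_closureE.
rewrite -subset0 => _ [[k Ck <-] Ak]; apply: h1.
by apply/strict_upperP; exists k.
Qed.

Lemma Inf_pinfty A : SU A = set0 -> Inf C A = [set +oo%E].
Proof. by move=> /upper_closure0 A0; rewrite /Inf; case: asboolP. Qed.

Lemma Inf_ninfty A : SU A = setT -> Inf C A = [set -oo%E].
Proof.
move=> /upper_closureT AT; rewrite /Inf; case: asboolP => [A0|_].
  by have := I : setT (0 : Y); rewrite -AT A0.
by case: asboolP.
Qed.

Lemma Inf_finite A : SU A <> set0 -> SU A <> setT ->
  Inf C A = EFin @` lower_frontier C° (SU A).
Proof.
move=> A0 AT; rewrite /Inf; case: asboolP => [/upper_closure0//|_].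
by case: asboolP => [/upper_closureT//|_]; rewrite wMin_upper_closure.
Qed.

Lemma Inf_EFin A y : Inf C A y%:E <-> lower_frontier C° (SU A) y.
Proof.
have [[k0 Ck0] _ _ _] := oC.
have [A0|A0] := pselect (SU A = set0).
  by rewrite Inf_pinfty// A0; split=> // -[_ /(_ _ Ck0)].
have [AT|AT] := pselect (SU A = setT).
  rewrite Inf_ninfty// AT; split => [//|[nT _]].
  by case: nT.
by rewrite Inf_finite//; split=> [[z ? [<-]]|?] //; exists y.
Qed.

Lemma Inf_has_pinfty A : Inf C A +oo%E -> SU A = set0.
Proof.
have [//|A0] := pselect (SU A = set0).
have [AT|AT] := pselect (SU A = setT); first by rewrite Inf_ninfty.
by rewrite Inf_finite// => -[].
Qed.

End InfimalSets.

(** * Lagrange duality *)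

(** The closure of [E] and its complement share their frontier; the reflection is
    the one that exchanges infimal and supremal sets. *)
Lemma lower_frontier_reflect (R : realType) (V : lmodType R) (K E : set V) :
  open_convex_cone K -> open_upper K E ->
  lower_frontier K [set y | ~ forall k, K k -> E (- y + k)] =
  [set y | lower_frontier K E (- y)].
Proof.
move=> [[k0 Kk0] _ scK _] [upE opE]; apply/seteqP; split=> y /= [].
  move=> /contrapT Ey nEy; split=> // Ey'.
  have [e e0 Ee] := opE _ _ Ey' Kk0.
  apply: (nEy (e *: k0)) => [|k Kk]; first exact: scK.
  by rewrite opprD; exact: upE.
move=> nEy Ey; split; first by apply.
by move=> k Kk /(_ k Kk); rewrite opprD subrK.
Qed.

(** A linear form bounded below on a ray does not decrease along it; this gives
    the signs of the separating functional on both cones. *)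
Lemma ge0_of_ray (R : realType) (a b c : R) :
  (forall t, 0 < t -> a <= b + t * c) -> 0 <= c.
Proof.
move=> h; rewrite leNgt; apply/negP => c0.
have ac : 0 < (`|b - a| + 1) / - c by rewrite divr_gt0 ?oppr_gt0// ltr_pwDr.
have := h _ ac; rewrite -[X in _ * X]opprK mulrN divfK ?lt0r_neq0 ?oppr_gt0//.
have := ler_norm (b - a); lra.
Qed.

Section Duality.
Set Implicit Arguments.
Unset Strict Implicit.
Context (R : realType) (X : lmodType R).
Context (Y : topologicalLmodType R) (U : tvsType R).
Variables (C : set Y) (D : set U) (F : X -> set (\bar Y)) (G : X -> set U).
Hypothesis cC : convex_cone C.
Hypothesis C_int_neq0 : C° !=set0.
Hypothesis cD : convex_cone D.
Hypothesis D_int_neq0 : D° !=set0.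

Local Notation SU := (strict_upper C°).
Let primal := \bigcup_(x in feasible D G) F x.
Let lagrangians (T : {linear U -> Y}) :=
  \bigcup_(x in [set: X]) Lagrangian F G x T.
Let dual := \bigcup_(T in Lplus C D) Phi C F G T.

Let oC : open_convex_cone C° := interior_open_convex_cone cC C_int_neq0.
Let oD : open_convex_cone D° := interior_open_convex_cone cD D_int_neq0.

Lemma strict_upper_lagrangians (T : {linear U -> Y}) y :
  SU (lagrangians T) y <-> exists x g, G x g /\ SU (F x) (y - T g).
Proof.
rewrite /lagrangians strict_upper_bigcup; split.
  case=> x _; rewrite /Lagrangian strict_upper_translate => -[_ [g Gg <-] Fg].
  by exists x, g.
case=> x [g [Gg Fg]]; exists x => //; rewrite /Lagrangian strict_upper_translate.
by exists (T g) => //; exists g.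
Qed.

(** A feasible [x] has some [- d] in [G x] with [d] in [D]; the term [T (- d)] of
    the Lagrangian is then in [- C] and can only lower the values of [F x]. *)
Lemma weak_duality (T : {linear U -> Y}) :
  Lplus C D T -> SU primal `<=` SU (lagrangians T).
Proof.
move=> [_ TD] y; rewrite /primal strict_upper_bigcup.
move=> [x [_ [/[swap] -[d Dd <-] Gd]] Fy].
apply/strict_upper_lagrangians; exists x, (- d); split => //.
rewrite linearN opprK; have CT : C (T d) by apply: TD; exists d.
case: Fy => [Foo|[a Fa Ka]]; [by left|right; exists a => //].
by rewrite addrAC addrC; exact: interior_convex_coneD.
Qed.

Hypothesis F_nonempty : forall x, F x !=set0.
Hypothesis F_convex : C_convex C F.
Hypothesis G_convex : D_convex D G.
Hypothesis slater :
  (\bigcup_(x in dom F) G x) `&` [set - d | d in D°] !=set0.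

(** The strict values that the perturbed problems reach: at a point [x], level
    [m.1] is reached when the constraint is relaxed by [m.2]. *)
Let epigraph : set (Y * U) := [set m | exists x g d,
  [/\ SU (F x) m.1, G x g, D° d & m.2 = g + d]].

Lemma slater_point : exists x y d,
  [/\ SU (F x) y, G x (- d) & D° d].
Proof.
have [k0 Ck0] := C_int_neq0.
have [u [[x domx Gx] [d Dd dE]]] := slater; rewrite -{u}dE in Gx.
have [a Fa anoo] : exists2 a, F x a & a <> +oo%E.
  apply: contrapT => nF; apply: domx; apply/seteqP.
  have Foo a : F x a -> a = +oo%E.
    by move=> Fa; apply: contrapT => anoo; apply: nF; exists a.
  split=> // _ ->; have [a Fa] := F_nonempty x.
  by rewrite -(Foo _ Fa).
case: a Fa anoo => [a||] Fa // _.
  exists x, (a + k0), d; split => //.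
  by right; exists a => //; rewrite addrC addKr.
by exists x, 0, d; split => //; left.
Qed.

Lemma primal_neq0 : SU primal !=set0.
Proof.
have [x [y [d [Fy Gd Dd]]]] := slater_point.
exists y; rewrite /primal strict_upper_bigcup; exists x => //.
by exists (- d); split=> //; exists d => //; exact: interior_subset.
Qed.

Lemma epigraph_convex (m n : Y * U) (l : R) : 0 < l -> l < 1 ->
  epigraph m -> epigraph n -> epigraph (l *: m + (1 - l) *: n).
Proof.
move=> l0 l1 [x [g [d [Fx Gx Dd mE]]]] [x' [g' [d' [Fx' Gx' Dd' nE]]]].
have [h Gh [e De he]] : [set u + d | u in G (l *: x + (1 - l) *: x') & d in D]
    (l *: g + (1 - l) *: g').
  by apply: (G_convex l0 l1); exists g => //; exists g'.
exists (l *: x + (1 - l) *: x'), h, (e + (l *: d + (1 - l) *: d')); split => //.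
- by apply: (preceq_strict_upper oC (F_convex l0 l1)); exact: strict_upper_conv.
- case: oD => _ addD scD _; apply: interior_convex_coneD => //.
  by apply: addD; apply: scD => //; rewrite subr_gt0.
- by rewrite addrA he addrACA -!scalerDr -mE -nE.
Qed.

Lemma epigraph_open : algebraically_open epigraph.
Proof.
move=> [y u] [v w] [x [g [d /= [Fy Gx Dd uE]]]].
have [e e0 Fe] : exists2 e : R, 0 < e &
    forall t, 0 <= t -> t <= e -> SU (F x) (y + t *: v).
  case: Fy => [Foo|[a Fa Ka]]; first by exists 1 => // t _ _; left.
  case: oC => _ _ _ /(_ _ v Ka)[e e0 Ce]; exists e => // t t0 te.
  by right; exists a => //; rewrite addrAC; exact: Ce.
have [e' e'0 De] := interior_algebraically_open w Dd.
exists (Num.min e e'); first by rewrite lt_min e0 e'0.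
move=> t t0; rewrite le_min => /andP[te te'].
exists x, g, (d + t *: w); split => //=; [exact: Fe|exact: De|].
by rewrite uE addrA.
Qed.

(** Infeasibility of the level [y0] says that [(y0, 0)] is outside the convex
    set [epigraph], hence [f (y, u) = ystar y + ustar u] separates them.
    Stability of [epigraph] under both cones makes [ystar] and [ustar]
    nonnegative on them. Slater's condition puts a point [(y1, 0)] in
    [epigraph], where [ystar y1 > ystar y0]; so [ystar] does not vanish, and it
    is positive on the interior of [C]. For [c] in this interior, normalized by
    [ystar c = 1], the operator [u |-> ustar u *: c] satisfies
    [ystar (T u) = ustar u], which turns the scalar separation into a statement
    about [T]. *)
Lemma exists_multiplier y0 : ~ SU primal y0 ->
  exists2 T, Lplus C D T & ~ SU (lagrangians T) y0.
Proof.
move=> ny0; have [x1 [y1 [d1 [Fy1 Gd1 Dd1]]]] := slater_point.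
have M1 y d : (forall z, SU (F x1) z -> SU (F x1) (z + y)) ->
    D° (d + d1) -> epigraph (y1 + y, d).
  by move=> hy hd; exists x1, (- d1), (d + d1); split=> //;
    [exact: hy|rewrite /= addrCA addNr addr0].
have [||||f fM] := @open_convex_separation R (Y * U)%type epigraph (y0, 0).
- exists (y1, 0); exists x1, (- d1), d1; split => //.
  by rewrite /= addNr.
- exact: epigraph_convex.
- exact: epigraph_open.
- case=> x [g [d [Fy Gg Dd gd]]]; apply: ny0.
  rewrite /primal strict_upper_bigcup; exists x => //; exists g; split => //.
  by exists d; [exact: interior_subset|apply/esym/eqP; rewrite -addr_eq0 -gd].
pose ystar y : R := f (y, 0); pose ustar u : R := f (0, u).
have fE y u : f (y, u) = ystar y + ustar u.
  by rewrite /ystar /ustar -linearD; congr (f (_, _)); rewrite ?addr0 ?add0r.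
have ylin (t : R) y z : ystar (t *: y + z) = t * ystar y + ystar z.
  rewrite /ystar -[t * _]/(t *: (f (y, 0) : R^o)) -linearP; congr (f (_, _)).
  by rewrite /= scaler0 addr0.
have ulin (t : R) y z : ustar (t *: y + z) = t * ustar y + ustar z.
  rewrite /ustar -[t * _]/(t *: (f (0, y) : R^o)) -linearP; congr (f (_, _)).
  by rewrite /= scaler0 addr0.
pose ustarL : {linear U -> R^o} :=
  HB.pack (ustar : U -> R^o) (GRing.isLinear.Build R U R^o *:%R ustar ulin).
have ystar_ge0 k : C° k -> 0 <= ystar k.
  move=> Ck; apply: (@ge0_of_ray R (f (y0, 0)) (ystar y1 + ustar 0)) => t t0.
  have /fM : epigraph (y1 + t *: k, 0).
    apply: M1; last by rewrite add0r.
    move=> z Fz; apply: (strict_upper_open oC (F x1)).1 => //.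
    by case: oC => _ _ scC _; exact: scC.
  by rewrite (fE (y1 + _)) [y1 + _]addrC ylin => /ltW; lra.
have ystarpos k : C° k -> 0 < ystar k.
  move=> Ck; have [e e0 /(_ _ (ltW e0) (lexx _))/ystar_ge0] :=
    interior_algebraically_open (y0 - y1) Ck.
  have /fM : epigraph (y1 + 0, 0) by apply: M1; rewrite ?add0r// => z; rewrite addr0.
  rewrite addr0 !fE => y01.
  rewrite [k + _]addrC ylin [y0 - y1]addrC -scaleN1r ylin mulN1r => ke.
  have : 0 < e * (ystar y1 - ystar y0) by rewrite mulr_gt0//; lra.
  lra.
have ustar_ge0 d : D d -> 0 <= ustar d.
  move=> Dd; apply: (@ge0_of_ray R (f (y0, 0)) (ystar y1 + ustar 0)) => t t0.
  have /fM : epigraph (y1 + 0, t *: d).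
    apply: M1 => [z|]; first by rewrite addr0.
    by apply: interior_convex_coneD => //; case: cD => _; apply => //; exact: ltW.
  by rewrite (fE (y1 + _)) addr0 -[t *: d]addr0 ulin => /ltW; lra.
have [c Cc yc] : exists2 c, C° c & ystar c = 1.
  have [k0 Ck0] := C_int_neq0; exists ((ystar k0)^-1 *: k0).
    by case: oC => _ _ scC _; apply: scC => //; rewrite invr_gt0 ystarpos.
  rewrite -[_ *: _]addr0 ylin mulVf ?gt_eqF ?ystarpos//.
  by rewrite /ystar linear0 addr0.
have Tlin : linear (fun u => ustar u *: c).
  by move=> t u v; rewrite ulin scalerDl scalerA.
pose T : {linear U -> Y} :=
  HB.pack (fun u => ustar u *: c)
    (GRing.isLinear.Build R U Y *:%R (fun u => ustar u *: c) Tlin).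
exists T.
  split; last first.
    move=> _ [d Dd <-]; case: cC => _; apply; first exact: ustar_ge0.
    exact: interior_subset.
  have cu : continuous ustarL by exact: (positive_linear_continuous (D := D)).
  move=> u A; rewrite -[T u]add0r => /nbhs_line/cu Au.
  have : nbhs u [set v | A (0 + ustarL v *: c)] := Au.
  by apply: filterS => v; rewrite /= add0r.
move=> /strict_upper_lagrangians[x [g [Gg]]].
have [_ opF] := strict_upper_open oC (F x).
move=> /opF/(_ Cc)[e e0 Fe].
have ud1 := ustar_ge0 _ (interior_subset Dd1).
have t0 : 0 < e / (ustar d1 + 1) by rewrite divr_gt0// ltr_pwDr.
(* a step of length [t = e / (ustar d1 + 1)] along [d1] makes the constraint part
   interior and raises [f] by [t * ustar d1 < e], less than the step back along
   [c] lowers it *)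
have /fM : epigraph (y0 - T g - e *: c, (e / (ustar d1 + 1)) *: d1 + g).
  exists x, g, ((e / (ustar d1 + 1)) *: d1); split => //=; last by rewrite addrC.
  by case: oD => _ _ scD _; exact: scD.
have -> : y0 - T g - e *: c = (- ustar g - e) *: c + y0.
  by rewrite scalerBl scaleNr [RHS]addrC addrA.
rewrite !fE ylin ulin yc.
have : e / (ustar d1 + 1) * (ustar d1 + 1) = e.
  by rewrite divfK// gt_eqF// ltr_pwDr.
have -> : ustar 0 = 0 by exact: linear0 ustarL.
rewrite mulrDr; set t := e / _ in t0 *; lra.
Qed.

(** Strong duality pointwise: a multiplier excludes [y] from the strict upper
    set of the Lagrangian, and weak duality keeps [y + C°] inside, so that [y]
    is an infimal point of the Lagrangian. *)
Lemma lower_frontier_dual y : lower_frontier C° (SU primal) y -> dual y%:E.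
Proof.
move=> [ny Cy]; have [T LT nTy] := exists_multiplier ny.
exists T => //; apply/Inf_EFin => //; split=> // k Ck.
by apply: weak_duality LT _ _; exact: Cy.
Qed.

Lemma dual_not_above_primal y : dual y%:E -> ~ SU primal y.
Proof. by move=> [T LT /(Inf_EFin oC)[nTy _]] /(weak_duality LT). Qed.

Lemma dual_neq_pinfty : ~ dual +oo%E.
Proof.
move=> [T LT /(Inf_has_pinfty oC) T0].
have [y /(weak_duality LT)] := primal_neq0.
by rewrite T0.
Qed.

(** A vector [z] whose translate [z + C°] leaves the strict upper set of the
    primal values lies strictly below a frontier point, which is a dual value;
    conversely no dual value is strictly above the closure of that set. *)
Lemma strict_upper_dual :
  SU (esetN dual) = [set y | ~ forall k, C° k -> SU primal (- y + k)].
Proof.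
apply/seteqP; split=> y.
  case=> [[[a||] // da _]|[_ [[a||] // da [<-]]]]; first by case: dual_neq_pinfty.
  rewrite opprK => Ca /(_ _ Ca).
  by rewrite addKr; exact: dual_not_above_primal.
move=> /existsNP[k /not_implyP[Ck nk]].
have [a /lower_frontier_dual da Ca] :=
  open_upper_ray oC (strict_upper_open oC primal) primal_neq0 Ck nk.
by right; exists (- a); [exists a%:E|move: Ca; rewrite !opprK addrC].
Qed.

Lemma null_Lplus : Lplus C D (\0 : {linear U -> Y}).
Proof.
split; first exact: cst_continuous.
have [k0 Ck0] := C_int_neq0; move=> _ [d _ <-] /=.
by rewrite -(scale0r k0); case: cC => _; apply=> //; exact: interior_subset.
Qed.

Lemma strong_duality : Sup C dual = Inf C primal.
Proof.
have uP : open_upper C° (SU primal) := strict_upper_open oC _.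
(* for an unbounded primal problem, weak duality makes every dual value [-oo] *)
rewrite /Sup; have [PT|PT] := pselect (SU primal = setT).
  have LT T : Lplus C D T -> Phi C F G T = [set -oo%E].
    move=> LT; apply: Inf_ninfty => //; rewrite -subTset => y _.
    by apply: (weak_duality LT); rewrite PT.
  have dE : esetN dual = [set +oo%E].
    apply/seteqP; split=> [_ [a [T TL Ta] <-]|_ ->].
      by move: Ta; rewrite LT// => ->.
    by exists -oo%E => //; exists \0; last rewrite LT//;
      exact: null_Lplus.
  rewrite (Inf_ninfty oC PT) dE Inf_pinfty//; last first.
    by rewrite -subset0 => y [//|[]].
  by apply/seteqP; split=> [_ [_ -> <-]|_ ->] //; exists +oo%E.
have [y0 Py0] := primal_neq0; have [k0 Ck0] := C_int_neq0.
rewrite !Inf_finite//.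
- rewrite strict_upper_dual lower_frontier_reflect//.
  apply/seteqP; split=> [_ [_ [y Py <-] <-]|_ [y Py <-]]; first by exists (- y).
  by exists (- y)%:E; rewrite /= ?opprK//; exists (- y) => //=; rewrite opprK.
- by move=> P0; rewrite P0 in Py0.
- rewrite strict_upper_dual => E0; apply: PT; rewrite -subTset => y _.
  apply: contrapT => ny.
  suff : (set0 : set Y) (- (y - k0)) by [].
  by rewrite -E0 /= opprK => /(_ _ Ck0); rewrite subrK.
- rewrite strict_upper_dual => ET.
  have : [set: Y] (- y0) by [].
  by rewrite -ET /= opprK; apply=> k Ck; exact: uP.1.
Qed.

End Duality.

Theorem theorem4p3 (R : realType) (X : lmodType R)
  (Y : topologicalLmodType R) (U : tvsType R)
  (C : set Y) (D : set U)
  (F : X -> set (\bar Y)) (G : X -> set U)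
  (C_convex_cone : convex_cone C)
  (C_int_neq0 : C° !=set0)
  (C_int_neqT : C° <> setT)
  (U_separated : hausdorff_space U)
  (D_convex_cone : convex_cone D)
  (D_closed : closed D)
  (D_proper : D <> setT)
  (D_int_neq0 : D° !=set0)
  (F_nonempty : forall x : X, F x !=set0)
  (F_convex : C_convex C F)
  (G_convex : D_convex D G)
  (slater : (\bigcup_(x in dom F) G x) `&` [set - d | d in D°] !=set0) :
  Sup C (\bigcup_(T in Lplus C D) Phi C F G T) =
  Inf C (\bigcup_(x in feasible D G) F x).
Proof. exact: strong_duality. Qed.
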